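(* Let $\mathcal{V}$ be a Schur-Baer variety, and let $\{G_i;\lambda_i^j,I\}$ be a directed system of finite groups. For each $i\in I$ let $G_i^*$ be a $\mathcal{V}$-covering group of $G_i$, and suppose that $\{G_i^*;\widetilde{\lambda}_i^j,I\}$ is an induced directed system of $\mathcal{V}$-covering groups of $\{G_i;\lambda_i^j,I\}$ (in the sense defined in the context). Then the group $G^*=\varinjlim G_i^*$ is a $\mathcal{V}$-covering group of $G=\varinjlim G_i$.
   Context: Let $\mathcal{V}$ be a variety of groups defined by a set of laws $V$. For a group $G$, $V(G)$ denotes the verbal subgroup (generated by all values in $G$ of words $v\in V$) and $V^*(G)$ the marginal subgroup, i.e. the set of $a\in G$ such that $v(g_1,\dots,g_ia,\dots,g_n)=v(g_1,\dots,g_n)$ for all $v\in V$, all $g_1,\dots,g_n\in G$ and all $1\le i\le n$. For a normal subgroup $R$ of a group $F$, $[RV^*F]$ denotes the least normal subgroup $N$ of $F$ contained in $R$ such that $R/N\subseteq V^*(F/N)$; equivalently the subgroup generated by all $v(f_1,\dots,f_{i-1},f_ir,f_{i+1},\dots,f_n)\,v(f_1,\dots,f_n)^{-1}$ with $r\in R$, $f_k\in F$, $v\in V$, $1\le i\le n$. For a group $G$ with a free presentation $1\to R\to F\to G\to 1$ ($F$ free), the Baer invariant is $\mathcal{V}M(G)=(R\cap V(F))/[RV^*F]$; it is abelian and independent of the presentation up to isomorphism. A $\mathcal{V}$-covering group of $G$ is a group $G^*$ with a normal subgroup $A$ such that $G^*/A\cong G$, $A\subseteq V(G^* )\cap V^*(G^*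 )$ and $A\cong\mathcal{V}M(G)$. $\mathcal{V}$ is a Schur-Baer variety if for every group $G$ with $G/V^*(G)$ finite, $V(G)$ is finite and $|V(G)|$ divides a power of $|G/V^*(G)|$. A directed system $\{G_i;\lambda_i^j,I\}$ of groups consists of groups $G_i$ indexed by a directed partially ordered set $I$ and homomorphisms $\lambda_i^j:G_i\to G_j$ for $i\le j$ with $\lambda_i^i=\mathrm{id}$ and $\lambda_i^k$ equal to $\lambda_i^j$ followed by $\lambda_j^k$ for $i\le j\le k$; $\varinjlim G_i$ is its direct limit. Induced directed system of $\mathcal{V}$-covering groups: for each $i\in I$ let $1\to R_i\to F_i\to G_i\to 1$ be the free presentation in which $F_i=F(G_i)$ is the free group on the underlying set of $G_i$ (with the canonical map to $G_i$), and for $i\le j$ let $\widehat{\lambda}_i^j:F_i\to F_j$ be the homomorphism induced by $\lambda_i^j$; it is compatible with $\lambda_i^j$ and maps $R_i$ into $R_j$. For each $i$ let $S_i$ be a normal subgroup of $F_i$ with $[R_iV^*F_i]\subseteq S_i\subseteq R_i$ such that $G_i^*=F_i/S_i$ and $$\frac{R_i}{[R_iV^*F_i]}=\frac{R_i\cap V(F_i)}{[R_iV^*F_i]}\times\frac{S_i}{[R_iV^*F_i]}$$ (internal direct product). If $\widehat{\lambda}_i^j(S_i)\subseteq S_j$ for all $i\le j$, then the induced homomorphisms $\widetilde{\lambda}_i^j:G_i^*=F_i/S_i\to G_j^*=F_j/S_j$ form a directed system $\{G_i^*;\widetilde{\lambda}_i^j,I\}$, which is called an induced directed system of $\mathcal{V}$-covering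 groups. *)

(* Defs.v *)
From HB Require Import structures.
From mathcomp Require Import all_boot all_order.
From mathcomp Require Import finmap.
From mathcomp Require Import boolp classical_sets functions cardinality.

Set Implicit Arguments.
Unset Strict Implicit.
Unset Printing Implicit Defensive.

Local Open Scope classical_set_scope.
Local Open Scope group_scope.
Local Open Scope quotient_scope.

Notation ghom := UMagmaMorphism.type.

Lemma gmulM_1 (G H : groupType) (f : G -> H) :
  {morph f : x y / x * y} -> f 1 = 1.
Proof. by move=> fM; apply: (@mulgI _ (f 1)); rewrite -fM !mulg1. Qed.

Section Subgroups.
Implicit Types G H : groupType.

Definition is_subgroup G (A : set G) : Prop :=
  [/\ A 1, (forall x y, A x -> A y -> A (x * y)) & forall x, A x -> A x^-1].

Definition is_normal G (A : set G) : Prop :=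
  is_subgroup A /\ forall x y, A x -> A (x ^ y).

Record nsubgroup G := NSubgroup {
  nsub_set :> set G;
  nsubP : is_normal nsub_set }.

Definition generated G (A : set G) : set G := smallest (@is_subgroup G) A.

Lemma generated_subgroup G (A : set G) : is_subgroup (generated A).
Proof.
split=> [H [[]//]|x y Ax Ay H HA|x Ax H HA].
- by case: (HA) => -[_ HM _] _; apply: HM; [apply: Ax|apply: Ay].
- by case: (HA) => -[_ _ HV] _; apply: HV; apply: Ax.
Qed.

Lemma generated_normal G (A : set G) :
  (forall x y, A x -> A (x ^ y)) -> is_normal (generated A).
Proof.
move=> AJ; split; first exact: generated_subgroup.
move=> x y Ax; have [g1 gM gV] := generated_subgroup A.
suff: generated A `<=` [set z | generated A (z ^ y)] by apply.
apply: smallest_sub => [|z Az]; last by apply: sub_gen_smallest; apply: AJ.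
split=> /= [|u v|u]; rewrite ?conj1g ?conjMg ?conjVg //.
- exact: gM.
- exact: gV.
Qed.

Lemma ker_normal G H (f : ghom G H) : is_normal [set x | f x = 1].
Proof.
split; first split=> /= [|x y fx fy|x fx].
- exact: gmulf1.
- by rewrite gmulfM fx fy mulg1.
- by rewrite gmulfV fx invg1.
- by move=> x y /= fx; rewrite gmulfJ fx conj1g.
Qed.

Definition ker G H (f : ghom G H) : nsubgroup G := NSubgroup (ker_normal f).

(* An isomorphism between a subgroup of G and a subgroup of H; whole groups
   are compared as [set: G] and [set: H]. *)
Definition isog G H (A : set G) (B : set H) : Prop :=
  exists f : G -> H,
    (forall x y, A x -> A y -> f (x * y) = f x * f y) /\ set_bij A B f.

(* A is the internal direct product of its normal subgroups B and C. *)
Definition internal_dprod G (A B C : set G) : Prop :=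
  [/\ is_subgroup A,
      [/\ is_subgroup B, B `<=` A & forall x y, B x -> A y -> B (x ^ y)],
      [/\ is_subgroup C, C `<=` A & forall x y, C x -> A y -> C (x ^ y)],
      B `&` C = [set 1] &
      A = [set x * y | x in B & y in C]].

End Subgroups.

Section Quotient.
Variables (G : groupType) (N : nsubgroup G).

Definition coset_rel : rel G := fun x y => `[< nsub_set N (x^-1 * y) >].

Lemma coset_rel_equiv : equiv_class_of coset_rel.
Proof.
have [[N1 NM NV] _] := nsubP N.
split=> [x|x y|y x z]; rewrite /coset_rel.
- by apply/asboolP; rewrite mulVg.
- by apply/asboolP/asboolP => /NV; rewrite invgM invgK.
- move=> /asboolP xy /asboolP yz; apply/asboolP.
  by have := NM _ _ xy yz; rewrite mulgA mulgK.
Qed.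

Canonical coset_equiv := EquivRelPack coset_rel_equiv.

Definition gquot := {eq_quot coset_equiv}.
HB.instance Definition _ := Choice.on gquot.

Definition coset (x : G) : gquot := \pi_{eq_quot coset_equiv} x.

Lemma coset_eq x y : coset x = coset y <-> nsub_set N (x^-1 * y).
Proof.
split=> [/eqmodP/asboolP //|xy]; apply/eqmodP; exact/asboolP.
Qed.

Lemma coset_repr (u : gquot) : coset (repr u) = u.
Proof. exact: reprK. Qed.

Lemma coset_surj (u : gquot) : exists x, coset x = u.
Proof. by exists (repr u); rewrite coset_repr. Qed.

Definition gquot_mul (u v : gquot) := coset (repr u * repr v).
Definition gquot_inv (u : gquot) := coset (repr u)^-1.

Lemma gquot_mulE x y : gquot_mul (coset x) (coset y) = coset (x * y).
Proof.
have [[_ NM _] NJ] := nsubP N.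
apply/coset_eq; rewrite invgM.
have /coset_eq ex := coset_repr (coset x).
have /coset_eq ey := coset_repr (coset y).
have := NM _ _ (NJ _ (repr (coset y)) ex) ey.
by rewrite /conjg !mulgA mulgK.
Qed.

Lemma gquot_invE x : gquot_inv (coset x) = coset x^-1.
Proof.
have [[_ _ NV] NJ] := nsubP N.
apply/coset_eq; have /coset_eq/NV/NJ := coset_repr (coset x).
by move=> /(_ (repr (coset x))^-1); rewrite invgM invgK /conjg invgK !mulgA mulgK.
Qed.

Lemma gquot_mulA : associative gquot_mul.
Proof.
move=> u v w; have [x <-] := coset_surj u; have [y <-] := coset_surj v.
by have [z <-] := coset_surj w; rewrite !gquot_mulE mulgA.
Qed.

Lemma gquot_mul1 : left_id (coset 1) gquot_mul.
Proof. by move=> u; have [x <-] := coset_surj u; rewrite gquot_mulE mul1g. Qed.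

Lemma gquot_1mul : right_id (coset 1) gquot_mul.
Proof. by move=> u; have [x <-] := coset_surj u; rewrite gquot_mulE mulg1. Qed.

Lemma gquot_mulV : left_inverse (coset 1) gquot_inv gquot_mul.
Proof.
by move=> u; have [x <-] := coset_surj u; rewrite gquot_invE gquot_mulE mulVg.
Qed.

Lemma gquot_Vmul : right_inverse (coset 1) gquot_inv gquot_mul.
Proof.
by move=> u; have [x <-] := coset_surj u; rewrite gquot_invE gquot_mulE mulgV.
Qed.

HB.instance Definition _ := isGroup.Build gquot
  gquot_mulA gquot_mul1 gquot_1mul gquot_mulV gquot_Vmul.

Lemma cosetM : {morph coset : x y / x * y}.
Proof. by move=> x y; rewrite -gquot_mulE. Qed.

HB.instance Definition _ := isMultiplicative.Build G gquot coset cosetM.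
HB.instance Definition _ := Multiplicative_isUMagmaMorphism.Build G gquot coset
  (gmulM_1 cosetM).

Lemma coset_eq1 x : coset x = 1 <-> nsub_set N x.
Proof.
rewrite -[1]/(coset 1); split=> [/esym/coset_eq|Nx].
- by rewrite invg1 mul1g.
- by apply/esym/coset_eq; rewrite invg1 mul1g.
Qed.

End Quotient.

Section QuotientMap.
Variables (G H : groupType) (N : nsubgroup G) (M : nsubgroup H) (f : ghom G H).
Hypothesis NfM : forall x, nsub_set N x -> nsub_set M (f x).

Definition quot_map (u : gquot N) : gquot M := coset M (f (repr u)).

Lemma quot_mapE x : quot_map (coset N x) = coset M (f x).
Proof.
apply/coset_eq; rewrite -gmulfV -gmulfM; apply: NfM.
by apply/coset_eq; rewrite coset_repr.
Qed.

Lemma quot_mapM : {morph quot_map : x y / x * y}.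
Proof.
move=> u v; have [x <-] := coset_surj u; have [y <-] := coset_surj v.
by rewrite -cosetM !quot_mapE gmulfM cosetM.
Qed.

End QuotientMap.

Section FreeGroup.
Variable X : choiceType.

(* The letter (x, false) stands for x and (x, true) for its inverse. *)
Definition word := seq (X * bool).

Inductive word_eq : word -> word -> Prop :=
| word_eq_refl w : word_eq w w
| word_eq_sym w1 w2 : word_eq w1 w2 -> word_eq w2 w1
| word_eq_trans w1 w2 w3 : word_eq w1 w2 -> word_eq w2 w3 -> word_eq w1 w3
| word_eq_cancel w1 w2 x b :
    word_eq (w1 ++ (x, b) :: (x, ~~ b) :: w2) (w1 ++ w2).

Definition free_rel : rel word := fun w1 w2 => `[< word_eq w1 w2 >].

Lemma free_rel_equiv : equiv_class_of free_rel.
Proof.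
split=> [w|w1 w2|w2 w1 w3]; rewrite /free_rel.
- by apply/asboolP; apply: word_eq_refl.
- by apply/asboolP/asboolP; apply: word_eq_sym.
- by move=> /asboolP h12 /asboolP h23; apply/asboolP; apply: word_eq_trans h23.
Qed.

Canonical free_equiv := EquivRelPack free_rel_equiv.

Definition freeGroup := {eq_quot free_equiv}.
HB.instance Definition _ := Choice.on freeGroup.

Definition free_class (w : word) : freeGroup := \pi_{eq_quot free_equiv} w.

Lemma free_class_eq w1 w2 : free_class w1 = free_class w2 <-> word_eq w1 w2.
Proof. by split=> [/eqmodP/asboolP //|h]; apply/eqmodP; exact/asboolP. Qed.

Lemma free_class_repr (u : freeGroup) : free_class (repr u) = u.
Proof. exact: reprK. Qed.

Lemma free_class_surj (u : freeGroup) : exists w, free_class w = u.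
Proof. by exists (repr u); rewrite free_class_repr. Qed.

Definition word_inv (w : word) : word := rev [seq (l.1, ~~ l.2) | l <- w].

Lemma word_eq_cat w1 w2 u1 u2 :
  word_eq w1 w2 -> word_eq u1 u2 -> word_eq (w1 ++ u1) (w2 ++ u2).
Proof.
move=> hw hu; apply: (@word_eq_trans _ (w2 ++ u1)).
- elim: hw u1 {hu} => [w|v1 v2 _ IH|v1 v2 v3 _ IH1 _ IH2|v1 v2 x b] u1.
  + exact: word_eq_refl.
  + exact: word_eq_sym.
  + exact: word_eq_trans (IH1 u1) (IH2 u1).
  + by rewrite -!catA /=; apply: word_eq_cancel.
- elim: hu w2 {hw} => [w|v1 v2 _ IH|v1 v2 v3 _ IH1 _ IH2|v1 v2 x b] w2.
  + exact: word_eq_refl.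
  + exact: word_eq_sym.
  + exact: word_eq_trans (IH1 w2) (IH2 w2).
  + by rewrite !catA; apply: word_eq_cancel.
Qed.

Lemma word_invK : involutive word_inv.
Proof.
move=> w; rewrite /word_inv map_rev revK -map_comp -[RHS]map_id.
by apply: eq_map => -[x b] /=; rewrite negbK.
Qed.

Lemma word_eq_inv w1 w2 : word_eq w1 w2 -> word_eq (word_inv w1) (word_inv w2).
Proof.
elim=> [w|v1 v2 _ IH|v1 v2 v3 _ IH1 _ IH2|v1 v2 x b].
- exact: word_eq_refl.
- exact: word_eq_sym.
- exact: word_eq_trans IH1 IH2.
- rewrite /word_inv !map_cat !rev_cat /= !rev_cons -!cats1 -!catA negbK /=.
  exact: word_eq_cancel.
Qed.

Lemma word_eq_mulV w : word_eq (w ++ word_inv w) [::].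
Proof.
elim: w => [|[x b] w IH]; first exact: word_eq_refl.
rewrite /word_inv /= rev_cons -cats1 catA.
have := word_eq_cat (word_eq_refl [:: (x, b)])
  (word_eq_cat IH (word_eq_refl [:: (x, ~~ b)])).
by move=> /word_eq_trans; apply; apply: (@word_eq_cancel [::] [::]).
Qed.

Definition free_mul (u v : freeGroup) := free_class (repr u ++ repr v).
Definition free_inv (u : freeGroup) := free_class (word_inv (repr u)).

Lemma free_mulE w1 w2 :
  free_mul (free_class w1) (free_class w2) = free_class (w1 ++ w2).
Proof.
by apply/free_class_eq; apply: word_eq_cat; apply/free_class_eq;
  rewrite free_class_repr.
Qed.

Lemma free_invE w : free_inv (free_class w) = free_class (word_inv w).
Proof.
by apply/free_class_eq; apply: word_eq_inv; apply/free_class_eq;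
  rewrite free_class_repr.
Qed.

Lemma free_mulA : associative free_mul.
Proof.
move=> u v w; have [x <-] := free_class_surj u.
have [y <-] := free_class_surj v; have [z <-] := free_class_surj w.
by rewrite !free_mulE catA.
Qed.

Lemma free_mul1 : left_id (free_class [::]) free_mul.
Proof. by move=> u; have [x <-] := free_class_surj u; rewrite free_mulE. Qed.

Lemma free_1mul : right_id (free_class [::]) free_mul.
Proof.
by move=> u; have [x <-] := free_class_surj u; rewrite free_mulE cats0.
Qed.

Lemma free_Vmul : right_inverse (free_class [::]) free_inv free_mul.
Proof.
move=> u; have [x <-] := free_class_surj u; rewrite free_invE free_mulE.
by apply/free_class_eq; apply: word_eq_mulV.
Qed.

Lemma free_mulV : left_inverse (free_class [::]) free_inv free_mul.
Proof.
move=> u; have [x <-] := free_class_surj u; rewrite free_invE free_mulE.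
by apply/free_class_eq; rewrite -{2}[x]word_invK; apply: word_eq_mulV.
Qed.

HB.instance Definition _ := isGroup.Build freeGroup
  free_mulA free_mul1 free_1mul free_mulV free_Vmul.

Lemma free_classM w1 w2 :
  free_class (w1 ++ w2) = free_class w1 * free_class w2.
Proof. by rewrite -free_mulE. Qed.

Definition free_gen (x : X) : freeGroup := free_class [:: (x, false)].

Section Lift.
Variables (G : groupType) (g : X -> G).

Definition word_eval (w : word) : G :=
  \prod_(l <- w) (if l.2 then (g l.1)^-1 else g l.1).

Lemma word_eval_eq w1 w2 : word_eq w1 w2 -> word_eval w1 = word_eval w2.
Proof.
elim=> [//|v1 v2 _ -> //|v1 v2 v3 _ -> _ -> //|v1 v2 x b].
rewrite /word_eval !big_cat !big_cons /=; congr (_ * _); rewrite mulgA.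
by case: b; rewrite /= ?mulVg ?mulgV mul1g.
Qed.

Definition free_lift (u : freeGroup) : G := word_eval (repr u).

Lemma free_liftE w : free_lift (free_class w) = word_eval w.
Proof. by apply: word_eval_eq; apply/free_class_eq; rewrite free_class_repr. Qed.

Lemma free_liftM : {morph free_lift : u v / u * v}.
Proof.
move=> u v; have [x <-] := free_class_surj u; have [y <-] := free_class_surj v.
by rewrite -free_classM !free_liftE /word_eval big_cat.
Qed.

HB.instance Definition _ :=
  isMultiplicative.Build freeGroup G free_lift free_liftM.
HB.instance Definition _ :=
  Multiplicative_isUMagmaMorphism.Build freeGroup G free_lift
    (gmulM_1 free_liftM).

Lemma free_lift_gen x : free_lift (free_gen x) = g x.
Proof. by rewrite /free_gen free_liftE /word_eval big_seq1. Qed.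

End Lift.

Lemma free_ind (P : freeGroup -> Prop) :
  P 1 -> (forall x u, P u -> P (free_gen x * u)) ->
  (forall x u, P u -> P ((free_gen x)^-1 * u)) -> forall u, P u.
Proof.
move=> P1 PM PV u; have [w <-] := free_class_surj u.
elim: w => [//|[x b] w IH]; rewrite -cat1s free_classM.
case: b; last exact: PM.
suff -> : free_class [:: (x, true)] = (free_gen x)^-1 by apply: PV.
by rewrite -[RHS]/(free_inv (free_gen x)) free_invE.
Qed.

Lemma free_hom_ext (G : groupType) (f h : ghom freeGroup G) :
  (forall x, f (free_gen x) = h (free_gen x)) -> f =1 h.
Proof.
move=> fh; apply: free_ind => [|x u IH|x u IH]; first by rewrite !gmulf1.
- by rewrite !gmulfM fh IH.
- by rewrite !gmulfM !gmulfV fh IH.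
Qed.

End FreeGroup.

Section VarietyDefs.
Variable V : set (freeGroup nat).
Implicit Types G H F : groupType.

(* A law is an element v of the free group on variables indexed by nat, and
   free_lift g v is its value v(g_0, g_1, ...).  Variables that do not occur
   in v contribute only trivial conditions and generators below. *)

Definition verbal G : set G :=
  generated [set free_lift g v | v in V & g in [set: nat -> G]].

Arguments verbal : clear implicits.

Definition marginal_set G : set G :=
  [set a | forall v (g : nat -> G) (i : nat), V v ->
     free_lift [eta g with i |-> g i * a] v = free_lift g v].

Definition marginal_comm_gens F (R : set F) : set F :=
  [set x | exists v (f : nat -> F) (i : nat) r,
    [/\ V v, R r &
     x = free_lift [eta f with i |-> f i * r] v * (free_lift f v)^-1]].

Lemma free_liftJ G (g : nat -> G) y v :
  free_lift (fun k => g k ^ y) v = free_lift g v ^ y.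
Proof.
elim/free_ind: v => [|x u IH|x u IH]; first by rewrite !gmulf1 conj1g.
- by rewrite !gmulfM /= !free_lift_gen IH conjMg.
- by rewrite !gmulfM /= !gmulfV /= !free_lift_gen IH conjMg conjVg.
Qed.

Lemma marginal_normal G : is_normal (@marginal_set G).
Proof.
split; first split=> [v g i Vv|a b Ma Mb v g i Vv|a Ma v g i Vv].
- congr (free_lift _ v); apply/funext => k /=.
  by case: eqP => // ->; rewrite mulg1.
- rewrite -(Ma v g i Vv) -[RHS](Mb v _ i Vv); congr (free_lift _ v).
  apply/funext => k /=.
  by case: (k =P i) => // _; rewrite eqxx mulgA.
- rewrite -[LHS](Ma v _ i Vv); congr (free_lift _ v).
  by apply/funext => k /=; case: (k =P i) => [->|_] //; rewrite eqxx mulgVK.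
- move=> a y Ma v g i Vv.
  apply: (@conjg_inj _ y^-1); rewrite -!free_liftJ -[RHS](Ma v _ i Vv).
  congr (free_lift _ v); apply/funext => k /=.
  by case: eqP => // _; rewrite conjMg conjgK.
Qed.

Definition marginal G : nsubgroup G := NSubgroup (marginal_normal G).

Lemma marginal_comm_normal F (R : nsubgroup F) :
  is_normal (generated (marginal_comm_gens R)).
Proof.
have [_ RJ] := nsubP R; apply: generated_normal.
move=> _ y [v [f [i [r [Vv Rr ->]]]]].
exists v, (fun k => f k ^ y), i, (r ^ y); split=> //; first exact: RJ.
rewrite conjMg conjVg -!free_liftJ; congr (free_lift _ v * _).
by apply/funext => k /=; case: eqP => // _; rewrite conjMg.
Qed.

(* The subgroup [RV*F]. *)
Definition marginal_comm F (R : nsubgroup F) : nsubgroup F :=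
  NSubgroup (marginal_comm_normal R).

Lemma hom_free_lift G H (f : ghom G H) (g : nat -> G) v :
  f (free_lift g v) = free_lift (f \o g) v.
Proof.
elim/free_ind: v => [|x u IH|x u IH]; first by rewrite !gmulf1.
- by rewrite !gmulfM /= !free_lift_gen IH.
- by rewrite !gmulfM /= !gmulfV /= !free_lift_gen IH.
Qed.

(* [RV*F] is the least normal subgroup N of F such that R/N is contained in
   V*(F/N), and it is contained in R. *)
Lemma marginal_commP F (R N : nsubgroup F) :
  coset N @` R `<=` marginal (gquot N) <-> marginal_comm R `<=` N.
Proof.
split=> [RN|MN _ [r Rr <-] v g i Vv].
- apply: smallest_sub; first by case: (nsubP N).
  move=> _ [v [f [i [r [Vv Rr ->]]]]]; apply/coset_eq1.
  rewrite cosetM gmulfV; apply/eqP; rewrite divg_eq1; apply/eqP; rewrite !hom_free_lift /=.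
  rewrite -[RHS](RN _ (imageP _ Rr) v (coset N \o f) i Vv); congr (free_lift _ v).
  by apply/funext => k /=; case: (k =P i) => // _; rewrite cosetM.
- have [f ->] : exists f : nat -> F, g = coset N \o f.
    exists (fun k => repr (g k)); apply/funext => k /=.
    by rewrite coset_repr.
  transitivity (free_lift (coset N \o [eta f with i |-> f i * r]) v).
    congr (free_lift _ v); apply/funext => k /=.
    by case: (k =P i) => // _; rewrite cosetM.
  rewrite -!hom_free_lift; apply/divg1_eq; rewrite -gmulfV -cosetM.
  apply/coset_eq1/MN; apply: sub_gen_smallest; by exists v, f, i, r.
Qed.

Lemma marginal_comm_sub F (R : nsubgroup F) : marginal_comm R `<=` R.
Proof.
apply/marginal_commP => _ [r Rr <-] v g i Vv.
congr (free_lift _ v); apply/funext => k /=.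
by case: eqP => // ->; have /coset_eq1 -> := Rr; rewrite mulg1.
Qed.

(* (R ∩ V(F)) / [RV*F], as a subgroup of F / [RV*F]. *)
Definition baer_of F (R : nsubgroup F) : set (gquot (marginal_comm R)) :=
  coset (marginal_comm R) @` (R `&` verbal F).

End VarietyDefs.
Arguments verbal V G : clear implicits.
Arguments marginal V G : clear implicits.
Arguments baer_of V {F} R.

Section PresentationIndependence.
Variable V : set (freeGroup nat).

Lemma verbal_hom (G H : groupType) (f : ghom G H) x :
  verbal V G x -> verbal V H (f x).
Proof.
have [V1 VM VV] := generated_subgroup
  [set free_lift g v | v in V & g in [set: nat -> H]].
suff: verbal V G `<=` [set z | verbal V H (f z)] by apply.
apply: smallest_sub; first split=> /= [|y z Vy Vz|y Vy].
- by rewrite gmulf1.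
- by rewrite gmulfM; apply: VM.
- by rewrite gmulfV; apply: VV.
move=> _ [v Vv [g _ <-]]; rewrite /= hom_free_lift.
by apply: sub_gen_smallest; exists v => //; exists (f \o g).
Qed.

Lemma marginal_comm_hom (F H : groupType) (R : nsubgroup F) (T : nsubgroup H)
    (f : ghom F H) : (forall x, nsub_set R x -> nsub_set T (f x)) ->
  forall x, nsub_set (marginal_comm V R) x -> nsub_set (marginal_comm V T) (f x).
Proof.
move=> RT; have [[T1 TM TV] _] := nsubP (marginal_comm V T).
suff: marginal_comm V R `<=` [set z | nsub_set (marginal_comm V T) (f z)].
  by apply.
apply: smallest_sub; first split=> /= [|y z Ty Tz|y Ty].
- by rewrite gmulf1.
- by rewrite gmulfM; apply: TM.
- by rewrite gmulfV; apply: TV.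
move=> _ [v [g [i [r [Vv Rr ->]]]]]; apply: sub_gen_smallest.
exists v, (f \o g), i, (f r); split=> //; first exact: RT.
rewrite gmulfM gmulfV !hom_free_lift; congr (free_lift _ v * _).
by apply/funext => k /=; case: (k =P i) => // _; rewrite gmulfM.
Qed.

Lemma free_lift_bound (v : freeGroup nat) : exists n, forall (G : groupType)
  (g h : nat -> G), (forall k, (k < n)%N -> g k = h k) ->
  free_lift g v = free_lift h v.
Proof.
elim/free_ind: v => [|x u [n IH]|x u [n IH]].
- by exists 0%N => G g h _; rewrite !gmulf1.
- exists (maxn x.+1 n) => G g h gh; rewrite !gmulfM /= !free_lift_gen.
  rewrite gh ?leq_max ?leqnn //; congr (_ * _); apply: IH => k kn.
  by apply: gh; rewrite leq_max kn orbT.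
- exists (maxn x.+1 n) => G g h gh; rewrite !gmulfM !gmulfV /= !free_lift_gen.
  rewrite gh ?leq_max ?leqnn //; congr (_ * _); apply: IH => k kn.
  by apply: gh; rewrite leq_max kn orbT.
Qed.

Lemma free_lift_marginal (G : groupType) (g a : nat -> G) v :
  V v -> (forall k, marginal_set V (a k)) ->
  free_lift (fun k => g k * a k) v = free_lift g v.
Proof.
move=> Vv Ma; have [n vn] := free_lift_bound v.
suff H m : free_lift (fun k => if (k < m)%N then g k * a k else g k) v
         = free_lift g v.
  by rewrite -(H n); apply: vn => k ->.
elim: m => [//|m <-]; rewrite -[RHS](Ma m v _ m Vv).
congr (free_lift _ v); apply/funext => k /=; rewrite ltnS ltnn leq_eqVlt.
by case: (k =P m) => // ->.
Qed.

Lemma verbal_endo (F : groupType) (R : nsubgroup F) (e : ghom F F) :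
  (forall x, nsub_set R (x^-1 * e x)) ->
  forall x, verbal V F x ->
  coset (marginal_comm V R) (e x) = coset (marginal_comm V R) x.
Proof.
move=> eR; set N := marginal_comm V R.
have RN : coset N @` R `<=` marginal V (gquot N) by apply/marginal_commP.
suff: verbal V F `<=` [set z | coset N (e z) = coset N z] by apply.
apply: smallest_sub; first split=> /= [|y z ey ez|y ey].
- by rewrite gmulf1.
- by rewrite gmulfM !cosetM ey ez.
- have cV z : coset N z^-1 = (coset N z)^-1 by exact: gmulfV.
  by rewrite gmulfV !cV ey.
move=> _ [v Vv [g _ <-]] /=; rewrite !hom_free_lift.
rewrite -(@free_lift_marginal _ (coset N \o g)
  (fun k => coset N ((g k)^-1 * e (g k)))) //.
- by congr (free_lift _ v); apply/funext => k /=; rewrite -cosetM mulVKg.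
- by move=> k; apply: RN; exists ((g k)^-1 * e (g k)).
Qed.

Lemma baer_of_isog (X Y : choiceType) (G : groupType)
    (p : ghom (freeGroup X) G) (q : ghom (freeGroup Y) G) :
  (forall x, exists u, p u = x) -> (forall x, exists u, q u = x) ->
  isog (baer_of V (ker p)) (baer_of V (ker q)).
Proof.
have lift (Z W : choiceType) (s : ghom (freeGroup Z) G)
    (t : ghom (freeGroup W) G) : (forall x, exists u, t u = x) ->
    exists f : ghom (freeGroup Z) (freeGroup W), forall u, t (f u) = s u.
  move=> /(_ _)/cid tsurj.
  exists (free_lift (fun z => sval (tsurj (s (free_gen z))))) => u.
  apply: (free_hom_ext (f := t \o free_lift _)) => z /=.
  by rewrite free_lift_gen; case: tsurj.
move=> /(lift _ _ q)[h ph] /(lift _ _ p)[f qf].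
have fR x : nsub_set (ker p) x -> nsub_set (ker q) (f x).
  by rewrite /= qf.
have hR x : nsub_set (ker q) x -> nsub_set (ker p) (h x).
  by rewrite /= ph.
have fN := marginal_comm_hom fR; have hN := marginal_comm_hom hR.
have hf x : verbal V _ x ->
    coset (marginal_comm V (ker p)) (h (f x)) = coset _ x.
  apply: (verbal_endo (e := h \o f)) => u /=.
  by rewrite gmulfM gmulfV ph qf mulVg.
have fh x : verbal V _ x ->
    coset (marginal_comm V (ker q)) (f (h x)) = coset _ x.
  apply: (verbal_endo (e := f \o h)) => u /=.
  by rewrite gmulfM gmulfV qf ph mulVg.
exists (@quot_map _ _ (marginal_comm V (ker p)) (marginal_comm V (ker q)) f).
split=> [x y _ _|]; first exact: quot_mapM.
split.
- move=> _ [x [Rx Vx] <-]; rewrite quot_mapE //; exists (f x) => //.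
  by split; [apply: fR|apply: verbal_hom].
- move=> u v /set_mem[x [_ Vx] <-] /set_mem[y [_ Vy] <-].
  rewrite !quot_mapE // => /(congr1 (@quot_map _ _ _ (marginal_comm V (ker p)) h)).
  by rewrite !quot_mapE // !hf.
- move=> _ [y [Ry Vy] <-]; exists (coset _ (h y)).
  + by exists (h y) => //; split; [apply: hR|apply: verbal_hom].
  + by rewrite quot_mapE // fh.
Qed.

End PresentationIndependence.

(* The free presentation 1 -> R -> F(G) -> G -> 1 on the underlying set of G. *)
Definition pres (G : groupType) : ghom (freeGroup G) G := free_lift (@id G).
Definition pres_ker (G : groupType) : nsubgroup (freeGroup G) := ker (pres G).

(* The Baer invariant does not depend on the presentation, up to isomorphism
   (baer_of_isog); it is taken here at the presentation of G on its underlying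
   set. *)
Definition baer_invariant (V : set (freeGroup nat)) (G : groupType) :
    set (gquot (marginal_comm V (pres_ker G))) :=
  baer_of V (pres_ker G).
Arguments baer_invariant V G : clear implicits.

Definition covering_group (V : set (freeGroup nat)) (Gs G : groupType) : Prop :=
  exists A : nsubgroup Gs,
    [/\ isog [set: gquot A] [set: G],
        A `<=` verbal V Gs `&` marginal V Gs &
        isog A (baer_invariant V G)].

Definition schur_baer (V : set (freeGroup nat)) : Prop :=
  forall G : groupType, finite_set [set: gquot (marginal V G)] ->
    finite_set (verbal V G) /\
    exists k : nat, (#|` fset_set (verbal V G)|
                       %| #|` fset_set [set: gquot (marginal V G)]| ^ k)%N.

Definition directed d (I : porderType d) : Prop :=
  inhabited I /\ forall i j : I, exists k : I, (i <= k)%O /\ (j <= k)%O.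

Record dirsys d (I : porderType d) := Dirsys {
  dgrp :> I -> groupType;
  dmap : forall i j, (i <= j)%O -> ghom (dgrp i) (dgrp j);
  dmap_id : forall i (ii : (i <= i)%O) x, dmap ii x = x;
  dmap_comp : forall i j k (ij : (i <= j)%O) (jk : (j <= k)%O) (ik : (i <= k)%O) x,
    dmap ik x = dmap jk (dmap ij x) }.

Section DirectLimit.
Context d (I : porderType d) (dI : directed I) (D : dirsys I).

(* The direct limit is the disjoint union of the D i, modulo eventual
   equality. *)
Definition dsum : choiceType := {i : I & D i}.

Definition dirlim_eq (x y : dsum) : Prop :=
  exists k (xk : (tag x <= k)%O) (yk : (tag y <= k)%O),
    dmap D xk (tagged x) = dmap D yk (tagged y).

Definition dirlim_rel : rel dsum := fun x y => `[< dirlim_eq x y >].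

Lemma dirlim_rel_equiv : equiv_class_of dirlim_rel.
Proof.
split=> [x|x y|y x z]; rewrite /dirlim_rel.
- by apply/asboolP; exists (tag x), (Order.POrderTheory.lexx _), (Order.POrderTheory.lexx _).
- by apply/asboolP/asboolP => -[k [xk [yk e]]]; exists k, yk, xk.
- move=> /asboolP[k [xk [yk e1]]] /asboolP[l [yl [zl e2]]]; apply/asboolP.
  have [m [km lm]] := dI.2 k l.
  have xm := Order.POrderTheory.le_trans xk km.
  have ym := Order.POrderTheory.le_trans yk km.
  have zm := Order.POrderTheory.le_trans zl lm.
  exists m, xm, zm; rewrite (dmap_comp xk km) e1 -(dmap_comp yk km ym).
  by rewrite (dmap_comp yl lm ym) e2 -(dmap_comp zl lm zm).
Qed.

Canonical dirlim_equiv := EquivRelPack dirlim_rel_equiv.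

Definition dirlim := {eq_quot dirlim_equiv}.
HB.instance Definition _ := Choice.on dirlim.

Definition dirlim_in (i : I) (x : D i) : dirlim :=
  \pi_{eq_quot dirlim_equiv} (Tagged (fun j => D j : Type) x).

Lemma dirlim_in_eq i j (x : D i) (y : D j) :
  dirlim_in x = dirlim_in y <->
  exists k (ik : (i <= k)%O) (jk : (j <= k)%O), dmap D ik x = dmap D jk y.
Proof. by split=> [/eqmodP/asboolP //|h]; apply/eqmodP; exact/asboolP. Qed.

Lemma dirlim_in_map i j (ij : (i <= j)%O) (x : D i) :
  dirlim_in (dmap D ij x) = dirlim_in x.
Proof.
apply/dirlim_in_eq; exists j, (Order.POrderTheory.lexx _), ij.
by rewrite dmap_id.
Qed.

Lemma dirlim_surj (u : dirlim) : exists i (x : D i), dirlim_in x = u.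
Proof.
exists (tag (repr u)), (tagged (repr u)).
by rewrite -[RHS]reprK /dirlim_in; case: (repr u).
Qed.

Lemma dirlim_surj2 (u v : dirlim) :
  exists i (x y : D i), dirlim_in x = u /\ dirlim_in y = v.
Proof.
have [i [x <-]] := dirlim_surj u; have [j [y <-]] := dirlim_surj v.
have [k [ik jk]] := dI.2 i j; exists k, (dmap D ik x), (dmap D jk y).
by rewrite !dirlim_in_map.
Qed.

Definition dirlim_1 : dirlim := dirlim_in (1 : D (inhabited_witness dI.1)).

Lemma dirlim_1E i : dirlim_in (1 : D i) = dirlim_1.
Proof.
have [k [ik jk]] := dI.2 i (inhabited_witness dI.1).
by apply/dirlim_in_eq; exists k, ik, jk; rewrite !gmulf1.
Qed.

Lemma dirlim_mul_ex (u v : dirlim) : exists w : dirlim,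
  exists i (x y : D i),
    [/\ dirlim_in x = u, dirlim_in y = v & dirlim_in (x * y) = w].
Proof.
by have [i [x [y [xu yv]]]] := dirlim_surj2 u v; exists (dirlim_in (x * y)), i, x, y.
Qed.

(* The product is computed in any common D i, see dirlim_mulE. *)
Definition dirlim_mul (u v : dirlim) : dirlim := sval (cid (dirlim_mul_ex u v)).

Lemma dirlim_mulE i (x y : D i) :
  dirlim_mul (dirlim_in x) (dirlim_in y) = dirlim_in (x * y).
Proof.
rewrite /dirlim_mul; case: cid => w /= [j [x' [y' [ex ey <-]]]].
have /dirlim_in_eq[k [jk [ik ek]]] := ex.
have /dirlim_in_eq[l [jl [il el]]] := ey.
have [m [km lm]] := dI.2 k l; apply/dirlim_in_eq.
have jm := Order.POrderTheory.le_trans jk km.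
have im := Order.POrderTheory.le_trans ik km.
exists m, jm, im; rewrite !gmulfM; congr (_ * _).
- by rewrite (dmap_comp jk km) ek -dmap_comp.
- by rewrite (dmap_comp jl lm) el -dmap_comp.
Qed.

Definition dirlim_inv (u : dirlim) : dirlim :=
  dirlim_in (tagged (repr u))^-1.

Lemma dirlim_invE i (x : D i) : dirlim_inv (dirlim_in x) = dirlim_in x^-1.
Proof.
have : dirlim_in (tagged (repr (dirlim_in x))) = dirlim_in x.
  by rewrite -[RHS]reprK {1}/dirlim_in; case: (repr _).
move=> /dirlim_in_eq[k [jk [ik ek]]]; apply/dirlim_in_eq.
by exists k, jk, ik; rewrite !gmulfV ek.
Qed.

Lemma dirlim_mulA : associative dirlim_mul.
Proof.
move=> u v w; have [i [x [y [<- <-]]]] := dirlim_surj2 u v.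
have [j [z <-]] := dirlim_surj w; have [k [ik jk]] := dI.2 i j.
rewrite -(dirlim_in_map ik x) -(dirlim_in_map ik y) -(dirlim_in_map jk z).
by rewrite !dirlim_mulE mulgA.
Qed.

Lemma dirlim_mul1 : left_id dirlim_1 dirlim_mul.
Proof.
move=> u; have [i [x <-]] := dirlim_surj u.
by rewrite -(dirlim_1E i) dirlim_mulE mul1g.
Qed.

Lemma dirlim_1mul : right_id dirlim_1 dirlim_mul.
Proof.
move=> u; have [i [x <-]] := dirlim_surj u.
by rewrite -(dirlim_1E i) dirlim_mulE mulg1.
Qed.

Lemma dirlim_mulV : left_inverse dirlim_1 dirlim_inv dirlim_mul.
Proof.
move=> u; have [i [x <-]] := dirlim_surj u.
by rewrite dirlim_invE dirlim_mulE mulVg dirlim_1E.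
Qed.

Lemma dirlim_Vmul : right_inverse dirlim_1 dirlim_inv dirlim_mul.
Proof.
move=> u; have [i [x <-]] := dirlim_surj u.
by rewrite dirlim_invE dirlim_mulE mulgV dirlim_1E.
Qed.

HB.instance Definition _ := isGroup.Build dirlim
  dirlim_mulA dirlim_mul1 dirlim_1mul dirlim_mulV dirlim_Vmul.

Lemma dirlim_inM i : {morph @dirlim_in i : x y / x * y}.
Proof. by move=> x y; rewrite -dirlim_mulE. Qed.

End DirectLimit.

Section InducedSystem.
Context d (I : porderType d) (D : dirsys I).

(* The map F(D i) -> F(D j) that sends the generator x to the generator
   dmap x. *)
Definition free_map i j (ij : (i <= j)%O) :
    ghom (freeGroup (D i)) (freeGroup (D j)) :=
  free_lift (fun x => free_gen (dmap D ij x)).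

Lemma free_map_gen i j (ij : (i <= j)%O) (x : D i) :
  free_map ij (free_gen x) = free_gen (dmap D ij x).
Proof. exact: free_lift_gen. Qed.

Lemma pres_free_map i j (ij : (i <= j)%O) u :
  pres (D j) (free_map ij u) = dmap D ij (pres (D i) u).
Proof.
elim/free_ind: u => [|x u IH|x u IH]; first by rewrite !gmulf1.
- by rewrite !gmulfM IH free_map_gen /= !free_lift_gen.
- by rewrite !gmulfM !gmulfV IH free_map_gen /= !free_lift_gen.
Qed.

Definition baer_complement (V : set (freeGroup nat)) (i : I)
    (S : nsubgroup (freeGroup (D i))) : Prop :=
  let R := pres_ker (D i) in
  let RVF := marginal_comm V R in
  [/\ RVF `<=` S, S `<=` R &
      internal_dprod (coset RVF @` R)
        (coset RVF @` (R `&` verbal V (freeGroup (D i))))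
        (coset RVF @` S)].

Variable S : forall i, nsubgroup (freeGroup (D i)).
Arguments S : clear implicits.

Definition free_map_compatible : Prop :=
  forall i j (ij : (i <= j)%O) u, nsub_set (S i) u -> nsub_set (S j) (free_map ij u).

Hypothesis cS : free_map_compatible.

Definition induced_map_fun i j (ij : (i <= j)%O) :
    gquot (S i) -> gquot (S j) :=
  @quot_map _ _ (S i) (S j) (free_map ij).

Lemma induced_mapE i j (ij : (i <= j)%O) u :
  induced_map_fun ij (coset (S i) u) = coset (S j) (free_map ij u).
Proof. exact/quot_mapE/cS. Qed.

Lemma induced_mapM i j (ij : (i <= j)%O) :
  {morph induced_map_fun ij : x y / x * y}.
Proof. exact/quot_mapM/cS. Qed.

HB.instance Definition _ i j (ij : (i <= j)%O) :=
  isMultiplicative.Build _ _ (induced_map_fun ij) (induced_mapM ij).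
HB.instance Definition _ i j (ij : (i <= j)%O) :=
  Multiplicative_isUMagmaMorphism.Build _ _ (induced_map_fun ij)
    (gmulM_1 (induced_mapM ij)).

Definition induced_map i j (ij : (i <= j)%O) :
  ghom (gquot (S i)) (gquot (S j)) := induced_map_fun ij.

Lemma free_map_id i (ii : (i <= i)%O) u : free_map ii u = u.
Proof.
by apply: (free_hom_ext (h := idfun)) => x; rewrite free_map_gen dmap_id.
Qed.

Lemma free_map_comp i j k (ij : (i <= j)%O) (jk : (j <= k)%O) (ik : (i <= k)%O)
  u : free_map ik u = free_map jk (free_map ij u).
Proof.
apply: (free_hom_ext (h := free_map jk \o free_map ij)) => x.
by rewrite /= !free_map_gen (dmap_comp ij jk).
Qed.

Lemma induced_map_id i (ii : (i <= i)%O) x : induced_map ii x = x.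
Proof.
by have [u <-] := coset_surj x; rewrite /= induced_mapE free_map_id.
Qed.

Lemma induced_map_comp i j k (ij : (i <= j)%O) (jk : (j <= k)%O)
  (ik : (i <= k)%O) x : induced_map ik x = induced_map jk (induced_map ij x).
Proof.
have [u <-] := coset_surj x.
by rewrite /= !induced_mapE (free_map_comp ij jk).
Qed.

Definition induced_dirsys : dirsys I :=
  @Dirsys d I (fun i => gquot (S i)) induced_map induced_map_id induced_map_comp.

End InducedSystem.

(* Main.v *)
(** Write [F] for the free group on [G = lim G_i] and [F_i] for the one on
    [G_i].  The maps [F_i -> F] are jointly surjective, [R = ker (F -> G)] is
    the union of the images of the [R_i], [V(F)] that of the [V(F_i)], and
    [G* = F / S] where [S] is the union of the images of the [S_i].  Hence the
    complement conditions at the [F_i] pass to [F]: [RV*F] is contained in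
    [S], [R = (R ∩ V(F)) S] and [R ∩ V(F) ∩ S] is contained in [RV*F].  These
    say exactly that [R / S] is marginal and verbal in [F / S] and isomorphic
    to [(R ∩ V(F)) / [RV*F]]. *)

Require Import Defs.
From HB Require Import structures.
From mathcomp Require Import all_boot all_order.
From mathcomp Require Import boolp classical_sets functions cardinality.
Local Open Scope classical_set_scope.


Set Implicit Arguments.
Unset Strict Implicit.
Unset Printing Implicit Defensive.
Local Open Scope group_scope.

(** * Covering groups as quotients of a presentation *)

Section CoveringQuotient.
Variables (V : set (freeGroup nat)) (F G H : groupType).
Variables (p : ghom F G) (q : ghom F H).
Hypothesis psurj : forall x, exists u, p u = x.
Hypothesis qsurj : forall x, exists u, q u = x.
Hypothesis qp : ker q `<=` ker p.

Lemma image_ker_normal : is_normal (q @` ker p).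
Proof.
have [[R1 RM RV] RJ] := nsubP (ker p).
split; first split.
- by exists 1 => //; rewrite gmulf1.
- by move=> _ _ [x Rx <-] [y Ry <-]; exists (x * y); rewrite ?gmulfM //; apply: RM.
- by move=> _ [x Rx <-]; exists x^-1; rewrite ?gmulfV //; apply: RV.
- move=> _ y [x Rx <-]; have [z <-] := qsurj y.
  by exists (x ^ z); rewrite ?gmulfJ //; apply: RJ.
Qed.

Definition image_ker : nsubgroup H := NSubgroup image_ker_normal.

(** Two preimages under [q] differ by an element of [ker q], which [p] kills as well, so any
    preimage can test membership. *)
Lemma image_kerP x : nsub_set image_ker (q x) <-> p x = 1.
Proof.
split=> [[r pr qr]|px]; last by exists x.
have /qp : nsub_set (ker q) (r^-1 * x) by rewrite /= gmulfM gmulfV qr mulVg.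
by rewrite /= gmulfM gmulfV pr invg1 mul1g.
Qed.

(** Third isomorphism theorem: both groups are [F] modulo [ker p]. *)
Lemma quot_image_ker_isog : isog [set: gquot image_ker] [set: G].
Proof.
have /(_ _)/cid section u : exists x, coset image_ker (q x) = u.
  by have [h <-] := coset_surj u; have [x <-] := qsurj h; exists x.
have cosetP x y :
    coset image_ker (q x) = coset image_ker (q y) <-> p x = p y.
  rewrite coset_eq -gmulfV -gmulfM; split.
    by move=> /image_kerP; rewrite gmulfM gmulfV => /mulg1_eq; rewrite invgK.
  by move=> e; apply/image_kerP; rewrite gmulfM gmulfV e mulVg.
have fE x : p (sval (section (coset image_ker (q x)))) = p x.
  by apply/cosetP; case: section.
exists (fun u => p (sval (section u))); split.
- move=> u v _ _; have [x <-] := section u; have [y <-] := section v.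
  by rewrite -cosetM -gmulfM !fE gmulfM.
- split=> //.
  + move=> u v _ _; have [x <-] := section u; have [y <-] := section v.
    by rewrite !fE => /cosetP.
  + move=> g _; have [x <-] := psurj g.
    by exists (coset image_ker (q x)) => //; apply: fE.
Qed.

(** [Nq] makes the kernel marginal, [pVq] makes it verbal, and [pVqN] separates its elements in the
    Baer invariant. *)
Hypothesis Nq : marginal_comm V (ker p) `<=` ker q.
Hypothesis pVq : forall x, p x = 1 ->
  exists2 y, p y = 1 /\ verbal V F y & q y = q x.
Hypothesis pVqN : forall x, verbal V F x -> q x = 1 ->
  nsub_set (marginal_comm V (ker p)) x.

Lemma image_ker_verbal : image_ker `<=` verbal V H.
Proof.
by move=> _ [x /pVq[y [_ Vy] <-] <-]; apply: verbal_hom.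
Qed.

Lemma image_ker_marginal : image_ker `<=` marginal V H.
Proof.
move=> _ [r pr <-] v g i Vv.
have /(_ _)/cid section := qsurj.
pose f k := sval (section (g k)).
have -> : g = q \o f.
  by apply/funext => k; rewrite /= (svalP (section (g k))).
(* Once the arguments are lifted through [q], the two values of [v] differ by the image of a
   generator of [[RV*F]], which [q] kills. *)
transitivity (free_lift (q \o [eta f with i |-> f i * r]) v).
  congr (free_lift _ v); apply/funext => k /=.
  by case: (k =P i) => // _; rewrite gmulfM.
rewrite -!hom_free_lift; apply/divg1_eq; rewrite -gmulfV -gmulfM.
by apply: Nq; apply: sub_gen_smallest; exists v, f, i, r.
Qed.

(** Second isomorphism theorem: each element of the kernel has a preimage in [R ∩ V(F)], unique
    modulo [[RV*F]]. *)
Lemma image_ker_isog : isog image_ker (baer_of V (ker p)).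
Proof.
have /(_ _)/cid section (h : H) :
    exists x, nsub_set image_ker h -> [/\ p x = 1, verbal V F x & q x = h].
  have [[r /pVq[y [py Vy] <-] qr]|nA] := pselect (nsub_set image_ker h).
    by exists y => _.
  (* A default value outside the kernel, which makes [section] total. *)
  by exists 1.
set N := marginal_comm V (ker p).
have [V1 VM VV] := generated_subgroup
  [set free_lift g v | v in V & g in [set: nat -> F]].
have cosetP x y : verbal V F x -> verbal V F y ->
    coset N x = coset N y <-> q x = q y.
  move=> Vx Vy; rewrite coset_eq; split=> [/Nq|e].
    by rewrite /= gmulfM gmulfV => /mulg1_eq; rewrite invgK.
  apply: pVqN; first by apply: VM => //; apply: VV.
  by rewrite gmulfM gmulfV e mulVg.
have [[_ AM _] _] := image_ker_normal.
exists (fun h => coset N (sval (section h))); split.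
- move=> h k Ah Ak; rewrite -cosetM.
  case: (section (h * k)) => x /= /(_ (AM _ _ Ah Ak))[_ Vx qx].
  case: (section h) => y /= /(_ Ah)[_ Vy qy].
  case: (section k) => z /= /(_ Ak)[_ Vz qz].
  by apply/cosetP => //; [exact: VM|rewrite gmulfM qx qy qz].
- split.
  + move=> h Ah; case: (section h) => x /= /(_ Ah)[px Vx _].
    by exists x.
  + move=> h k /set_mem Ah /set_mem Ak.
    case: (section h) => y /= /(_ Ah)[_ Vy qy].
    case: (section k) => z /= /(_ Ak)[_ Vz qz].
    by move=> /cosetP; rewrite qy qz; apply.
  + move=> _ [x [px Vx] <-].
    have Ax : nsub_set image_ker (q x) by exists x.
    exists (q x) => //; case: (section (q x)) => y /= /(_ Ax)[_ Vy qy].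
    exact/cosetP.
Qed.

End CoveringQuotient.

Lemma pres_surj (G : groupType) (x : G) : exists u, pres G u = x.
Proof. by exists (free_gen x); apply: free_lift_gen. Qed.

(** * The free group on a direct limit *)

Section DirectLimitMaps.
Context d (I : porderType d) (dI : directed I) (D : dirsys I).

HB.instance Definition _ i := isMultiplicative.Build (D i) (dirlim dI D)
  (@dirlim_in d I dI D i) (@dirlim_inM d I dI D i).
HB.instance Definition _ i :=
  Multiplicative_isUMagmaMorphism.Build (D i) (dirlim dI D)
    (@dirlim_in d I dI D i) (gmulM_1 (@dirlim_inM d I dI D i)).

Lemma dirlim_in_eq1 i (x : D i) :
  dirlim_in dI x = 1 <-> exists j (ij : (i <= j)%O), dmap D ij x = 1.
Proof.
split=> [|[j [ij e]]].
- have <- : dirlim_in dI (1 : D i) = 1 by apply: dirlim_1E.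
  move=> /dirlim_in_eq[k [ik [jk e]]].
  by exists k, ik; rewrite e gmulf1.
- by rewrite -(dirlim_in_map dI ij) e gmulf1.
Qed.

Definition free_in i : ghom (freeGroup (D i)) (freeGroup (dirlim dI D)) :=
  free_lift (fun x => free_gen (dirlim_in dI x)).

Lemma free_in_gen i (x : D i) :
  free_in i (free_gen x) = free_gen (dirlim_in dI x).
Proof. exact: free_lift_gen. Qed.

Lemma free_in_map i j (ij : (i <= j)%O) u :
  free_in j (free_map D ij u) = free_in i u.
Proof.
apply: (free_hom_ext (f := free_in j \o free_map D ij)) => x.
by rewrite /= free_map_gen !free_in_gen dirlim_in_map.
Qed.

Lemma pres_free_in i u :
  pres (dirlim dI D) (free_in i u) = dirlim_in dI (pres (D i) u).
Proof.
apply: (free_hom_ext (f := pres _ \o free_in i)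
  (h := @dirlim_in d I dI D i \o pres (D i))) => x.
by rewrite /= free_in_gen !free_lift_gen.
Qed.

(** Directedness yields a common stage for finitely many elements only; this suffices because a law
    involves finitely many variables ([free_lift_bound]). *)
Lemma free_in_lift n (f : nat -> freeGroup (dirlim dI D)) :
  exists i (g : nat -> freeGroup (D i)),
    forall k, (k < n)%N -> free_in i (g k) = f k.
Proof.
have one u : exists i w, free_in i w = u.
  elim/free_ind: u => [|x u [i [w <-]]|x u [i [w <-]]].
  - by exists (inhabited_witness dI.1), 1; rewrite gmulf1.
  - have [j [y <-]] := dirlim_surj x; have [k [ik jk]] := dI.2 i j.
    exists k, (free_gen (dmap D jk y) * free_map D ik w).
    by rewrite gmulfM free_in_map free_in_gen dirlim_in_map.
  - have [j [y <-]] := dirlim_surj x; have [k [ik jk]] := dI.2 i j.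
    exists k, ((free_gen (dmap D jk y))^-1 * free_map D ik w).
    by rewrite gmulfM gmulfV free_in_map free_in_gen dirlim_in_map.
elim: n => [|n [i [g gf]]].
  by exists (inhabited_witness dI.1), (fun=> 1).
have [j [w wf]] := one (f n); have [k [ik jk]] := dI.2 i j.
exists k, (fun m => if m == n then free_map D jk w else free_map D ik (g m)).
move=> m; rewrite ltnS leq_eqVlt; case: eqP => [-> _|_ /= mn].
- by rewrite free_in_map.
- by rewrite free_in_map gf.
Qed.

Lemma free_in_surj u : exists i w, free_in i w = u.
Proof.
have [i [g gu]] := free_in_lift 1 (fun=> u).
by exists i, (g 0%N); apply: gu.
Qed.

Lemma verbal_free_in V u : verbal V (freeGroup (dirlim dI D)) u ->
  exists i w, verbal V (freeGroup (D i)) w /\ free_in i w = u.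
Proof.
pose P u := exists i w, verbal V (freeGroup (D i)) w /\ free_in i w = u.
have sg i := generated_subgroup
  [set free_lift g v | v in V & g in [set: nat -> freeGroup (D i)]].
suff: verbal V (freeGroup (dirlim dI D)) `<=` P by apply.
apply: smallest_sub; first split.
- exists (inhabited_witness dI.1), 1; rewrite gmulf1; split=> //.
  by have [] := sg (inhabited_witness dI.1).
- move=> _ _ [i [x [Vx <-]]] [j [y [Vy <-]]]; have [k [ik jk]] := dI.2 i j.
  exists k, (free_map D ik x * free_map D jk y).
  rewrite gmulfM !free_in_map; split=> //.
  by have [_ VM _] := sg k; apply: VM; apply: verbal_hom.
- move=> _ [i [x [Vx <-]]]; exists i, x^-1; rewrite gmulfV; split=> //.
  by have [_ _ VV] := sg i; apply: VV.
- move=> _ [v Vv [f _ <-]]; have [n vn] := free_lift_bound v.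
  have [i [g gf]] := free_in_lift n f; exists i, (free_lift g v); split.
    by apply: sub_gen_smallest; exists v => //; exists g.
  by rewrite hom_free_lift; apply: vn.
Qed.

(** A lift of [u] need not be a relation at its own stage, but its image in the group becomes
    trivial at a later one. *)
Lemma ker_free_in u : pres (dirlim dI D) u = 1 ->
  exists i w, pres (D i) w = 1 /\ free_in i w = u.
Proof.
have [i [w <-]] := free_in_surj u.
rewrite pres_free_in => /dirlim_in_eq1[j [ij e]].
by exists j, (free_map D ij w); rewrite pres_free_map free_in_map.
Qed.

(** Descending the generators is enough to place [[RV*F]] inside a kernel, which is a subgroup. *)
Lemma marginal_comm_gens_free_in V u :
  marginal_comm_gens V (pres_ker (dirlim dI D)) u ->
  exists i w, marginal_comm_gens V (pres_ker (D i)) w /\ free_in i w = u.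
Proof.
move=> [v [f [m [r [Vv Rr ->]]]]]; have [n vn] := free_lift_bound v.
(* The bound covers the variables of [v] and also the modified index [m], which may lie beyond
   [n]. *)
have [i [g gf]] := free_in_lift (maxn n m.+1) f.
have [j [s [ps sr]]] := ker_free_in Rr; have [k [ik jk]] := dI.2 i j.
pose g' := free_map D ik \o g; pose s' := free_map D jk s.
have g'f l : (l < maxn n m.+1)%N -> free_in k (g' l) = f l.
  by move=> lm; rewrite /g' /= free_in_map gf.
exists k, (free_lift [eta g' with m |-> g' m * s'] v * (free_lift g' v)^-1).
split.
  by exists v, g', m, s'; split=> //; rewrite /= pres_free_map ps gmulf1.
rewrite gmulfM gmulfV !hom_free_lift; congr (_ * _^-1); apply: vn => l ln /=.
- case: (l =P m) => [lm|_]; last by rewrite g'f // leq_max ln.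
  by rewrite gmulfM g'f ?leq_max ?leqnn ?orbT // free_in_map sr.
- by rewrite g'f // leq_max ln.
Qed.

End DirectLimitMaps.

Arguments free_in {d I} dI {D} i.

(** * The limit of the covering groups as a quotient of the free group *)

Section InducedPresentation.
Context d (I : porderType d) (dI : directed I) (D : dirsys I).
Variable S : forall i, nsubgroup (freeGroup (D i)).
Hypothesis cS : free_map_compatible S.
Let Ds := induced_dirsys cS.

(** Each generator is an element of the limit, sent to its class at the stage of a chosen
    representative; [induced_presE] shows that the choice is immaterial. *)
Definition induced_pres : ghom (freeGroup (dirlim dI D)) (dirlim dI Ds) :=
  free_lift (fun u : dirlim dI D =>
    @dirlim_in d I dI Ds (tag (repr u))
      (coset (S (tag (repr u))) (free_gen (tagged (repr u))))).

Lemma induced_presE i w :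
  induced_pres (free_in dI i w) = @dirlim_in d I dI Ds i (coset (S i) w).
Proof.
apply: (free_hom_ext (f := induced_pres \o free_in dI i)
  (h := @dirlim_in d I dI Ds i \o coset (S i))) => x.
rewrite /= free_in_gen free_lift_gen.
have : dirlim_in dI (tagged (repr (dirlim_in dI x))) = dirlim_in dI x.
  by rewrite -[RHS]reprK {1}/dirlim_in; case: (repr _).
(* The chosen representative and [x] coincide at some stage [k], hence so do the corresponding free
   generators. *)
move=> /dirlim_in_eq[k [jk [ik ek]]]; apply/dirlim_in_eq; exists k, jk, ik.
by rewrite /= !(induced_mapE cS) !free_map_gen ek.
Qed.

Lemma induced_pres_surj x : exists u, induced_pres u = x.
Proof.
have [i [y <-]] := dirlim_surj x; have [w <-] := coset_surj y.
by exists (free_in dI i w); rewrite induced_presE.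
Qed.

Lemma induced_pres_eq1 i w : induced_pres (free_in dI i w) = 1 <->
  exists j (ij : (i <= j)%O), nsub_set (S j) (free_map D ij w).
Proof.
rewrite induced_presE dirlim_in_eq1.
by split=> -[j [ij e]]; exists j, ij; move: e; rewrite /= (induced_mapE cS) coset_eq1.
Qed.

End InducedPresentation.

(** * Passage of the complement conditions to the limit *)

Theorem theorem3p5 (V : set (freeGroup nat)) (hV : schur_baer V)
    (d : Order.disp_t) (I : porderType d) (dI : directed I)
    (G : dirsys I) (finG : forall i : I, finite_set [set: G i])
    (S : forall i : I, nsubgroup (freeGroup (G i)))
    (covG : forall i : I, covering_group V (gquot (S i)) (G i))
    (complS : forall i : I, baer_complement V (S i))
    (compS : free_map_compatible S) :
  covering_group V (dirlim dI (induced_dirsys compS)) (dirlim dI G).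
Proof.
pose L := dirlim dI G; pose q := induced_pres dI compS.
have qS i w : nsub_set (S i) w -> q (free_in dI i w) = 1.
  by move=> Sw; rewrite /q induced_presE; have /coset_eq1 -> := Sw; rewrite gmulf1.
have SR i w : nsub_set (S i) w -> nsub_set (pres_ker (G i)) w.
  by have [_ SR _] := complS i => /SR.
have kerE i w : nsub_set (pres_ker (G i)) w -> nsub_set (pres_ker L) (free_in dI i w).
  by move=> pw; rewrite /= pres_free_in; have /= -> := pw; rewrite gmulf1.
have qp : ker q `<=` ker (pres L).
  move=> u; have [i [w <-]] := free_in_surj u.
  move=> /induced_pres_eq1[j [ij /SR e]].
  by rewrite -(free_in_map dI ij); apply: kerE.
have pVq x : pres L x = 1 ->
    exists2 y, pres L y = 1 /\ verbal V (freeGroup L) y & q y = q x.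
  move=> /ker_free_in[i [w [pw <-]]].
  have [NS _ [_ _ _ _ decomp]] := complS i.
  have : (coset (marginal_comm V (pres_ker (G i))) @` pres_ker (G i)) (coset _ w).
    by exists w.
  rewrite decomp => -[_ [y [py Vy] <-] [_ [s Ss <-]]].
  rewrite -cosetM => /coset_eq/NS Sr.
  exists (free_in dI i y); first by split; [apply: kerE|apply: verbal_hom].
  (* The decomposition holds modulo [[R_iV*F_i]] only; the error term lies in [S_i], so [q] kills it
     along with [s]. *)
  have -> : w = y * s * ((y * s)^-1 * w) by rewrite mulVKg.
  by move: Sr => /qS; set r := _ * w; rewrite !gmulfM => ->; rewrite (qS _ s Ss) !mulg1.
have pVqN x : verbal V (freeGroup L) x -> q x = 1 ->
    nsub_set (marginal_comm V (pres_ker L)) x.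
  move=> /verbal_free_in[i [w [Vw <-]]] /induced_pres_eq1[j [ij Sw]].
  (* The complement condition is used at stage [j], where the word has entered [S_j]: its class then
     lies in both direct factors, hence is trivial. *)
  have [_ _ [_ _ _ trivI _]] := complS j.
  rewrite -(free_in_map dI ij).
  apply: (marginal_comm_hom (R := pres_ker (G j))); first exact: kerE.
  apply/coset_eq1; suff : [set 1] (coset (marginal_comm V (pres_ker (G j)))
    (free_map G ij w)) by [].
  rewrite -trivI; split; exists (free_map G ij w) => //.
  by split; [apply: SR|apply: verbal_hom].
have Nq : marginal_comm V (pres_ker L) `<=` ker q.
  apply: smallest_sub; first by have [] := ker_normal q.
  move=> _ /marginal_comm_gens_free_in[i [w [Nw <-]]]; apply: qS.
  by have [NS _ _] := complS i; apply: NS; apply: sub_gen_smallest.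
have qsurj := @induced_pres_surj _ _ dI _ _ compS.
exists (image_ker (pres L) qsurj); split.
- exact/quot_image_ker_isog/qp/pres_surj.
- move=> x Ax; split; first exact: (image_ker_verbal pVq Ax).
  exact: (image_ker_marginal Nq Ax).
- exact: image_ker_isog.
Qed.
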